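(* There is a locally countable partial order $(P,\leq_P)$ of size continuum and height three with the following properties: (1) the first level $P_1$ of $P$ has size continuum; (2) if $f$ is any function from $P$ into the Turing degrees such that the image of $f$ on $P_1$ contains a perfect set (i.e. there is a perfect set $A\subseteq 2^\omega$ such that the Turing degree of every element of $A$ lies in $f(P_1)$), then $f$ is not an embedding.
   Context: A partial order $(P,\leq_P)$ is locally countable if every element has at most countably many strict predecessors. It has height $n$ if its longest chain has length exactly $n$. For a partial order of finite height, its first level consists of the elements with no strict predecessors, its second level consists of the elements not in the first level all of whose strict predecessors lie in the first level, and its third level consists of elements not in the first two levels all of whose strict predecessors lie in the first two levels. An embedding into the Turing degrees is a map $f$ with $x\leq_P y\iff f(x)\leq_T f(y)$ for all $x,y\in P$. A perfect set is a nonempty closed subset of $2^\omega$ without isolated points. *)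

(* Defs.v *)
From Stdlib Require Import List Arith.
Import ListNotations.

(** * Oracle partial recursive functionals (Kleene), used to define Turing reducibility *)
Inductive code : Type :=
| Zero : code
| Succ : code
| Proj : nat -> code
| Orc : code
| Comp : code -> list code -> code
| Prec : code -> code -> code
| Mu : code -> code.

Definition b2n (b : bool) : nat := if b then 1 else 0.

Inductive eval (o : nat -> bool) : code -> list nat -> nat -> Prop :=
| eZero v : eval o Zero v 0
| eSucc x v : eval o Succ (x :: v) (S x)
| eProj i v : i < length v -> eval o (Proj i) v (nth i v 0)
| eOrc x v : eval o Orc (x :: v) (b2n (o x))
| eComp f gs v ws y : evals o gs v ws -> eval o f ws y -> eval o (Comp f gs) v y
| ePrec0 f g v y : eval o f v y -> eval o (Prec f g) (0 :: v) y
| ePrecS f g n v r y :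
    eval o (Prec f g) (n :: v) r -> eval o g (n :: r :: v) y ->
    eval o (Prec f g) (S n :: v) y
| eMu f v n :
    eval o f (n :: v) 0 ->
    (forall m, m < n -> exists k, eval o f (m :: v) (S k)) ->
    eval o (Mu f) v n
with evals (o : nat -> bool) : list code -> list nat -> list nat -> Prop :=
| esNil v : evals o [] v []
| esCons g gs v y ys : eval o g v y -> evals o gs v ys -> evals o (g :: gs) v (y :: ys).

Definition turing_le (x y : nat -> bool) : Prop :=
  exists c : code, forall n, eval y c [n] (b2n (x n)).

Definition turing_eq (x y : nat -> bool) : Prop := turing_le x y /\ turing_le y x.

Definition agree_upto (n : nat) (x y : nat -> bool) : Prop :=
  forall k, k < n -> x k = y k.

Definition closed_set (A : (nat -> bool) -> Prop) : Prop :=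
  forall x, (forall n, exists y, A y /\ agree_upto n x y) -> A x.

Definition no_isolated (A : (nat -> bool) -> Prop) : Prop :=
  forall x, A x -> forall n, exists y, A y /\ y <> x /\ agree_upto n x y.

Definition perfect_set (A : (nat -> bool) -> Prop) : Prop :=
  (exists x, A x) /\ closed_set A /\ no_isolated A.

Definition partial_order {P : Type} (le : P -> P -> Prop) : Prop :=
  (forall x, le x x) /\
  (forall x y, le x y -> le y x -> x = y) /\
  (forall x y z, le x y -> le y z -> le x z).

Definition lt_of {P : Type} (le : P -> P -> Prop) (x y : P) : Prop := le x y /\ x <> y.

Definition countable_set {P : Type} (S : P -> Prop) : Prop :=
  exists g : P -> nat, forall x y, S x -> S y -> g x = g y -> x = y.

Definition locally_countable {P : Type} (le : P -> P -> Prop) : Prop :=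
  forall y, countable_set (fun x => lt_of le x y).

Definition size_continuum {P : Type} (S : P -> Prop) : Prop :=
  exists h : (nat -> bool) -> P,
    (forall r, S (h r)) /\
    (forall r s, h r = h s -> r = s) /\
    (forall x, S x -> exists r, h r = x).

Definition height3 {P : Type} (le : P -> P -> Prop) : Prop :=
  (exists a b c, lt_of le a b /\ lt_of le b c) /\
  ~ (exists a b c d, lt_of le a b /\ lt_of le b c /\ lt_of le c d).

Definition first_level {P : Type} (le : P -> P -> Prop) (x : P) : Prop :=
  forall y, ~ lt_of le y x.

(** f (choosing a representative of each degree) is an embedding into the Turing degrees *)
Definition turing_embedding {P : Type} (le : P -> P -> Prop) (f : P -> nat -> bool) : Prop :=
  forall x y, le x y <-> turing_le (f x) (f y).

(* Main.v *)
(* Let the poset consist of points, of bounds of countable sets of points, and of joint bounds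
   of such a bound with countably many further points. Suppose an embedding [f] sends points
   onto a set containing a perfect set [A], let [b_i] be dense in [A], and let [X] be the
   image of the bound of the corresponding points. Then [X] computes every [b_i], though not
   uniformly. Every real [y] is computable from [X] together with six elements of [A], so the
   joint bounds lie above too much.

   The six reals follow elements of [b], departing from them infinitely often. A departure can
   be made arbitrarily late, and once the decoder knows a program computing from [X] the
   element being followed, it can find the departure by searching for a disagreement. So
   departures provide arbitrarily large numbers [t] and then [s]. These suffice to find a
   program for the element followed by another real: it is the least program that, within
   [s] steps, agrees with that real below [t]. With three pairs of reals departing in turn,
   each program is found from the departures of the other two pairs, and the order in which
   the two reals of a pair depart codes a bit of [y]. *)
From Stdlib Require Import List Arith Lia Classical IndefiniteDescription ChoiceFacts
  FunctionalExtensionality.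
From Stdlib Require Cantor.
Require Import Defs.
Import ListNotations.

Definition real : Type := nat -> bool.
Definition nat_of (x : real) (k : nat) : nat := b2n (x k).

(** * Computable functions *)

Definition computable (o : real) (n : nat) (F : list nat -> nat) : Prop :=
  exists c, forall v, length v = n -> eval o c v (F v).

Definition computable1 o (f : nat -> nat) : Prop :=
  computable o 1 (fun v => f (nth 0 v 0)).
Definition computable2 o (f : nat -> nat -> nat) : Prop :=
  computable o 2 (fun v => f (nth 0 v 0) (nth 1 v 0)).
Definition computable3 o (f : nat -> nat -> nat -> nat) : Prop :=
  computable o 3 (fun v => f (nth 0 v 0) (nth 1 v 0) (nth 2 v 0)).
Definition computable4 o (f : nat -> nat -> nat -> nat -> nat) : Prop :=
  computable o 4 (fun v => f (nth 0 v 0) (nth 1 v 0) (nth 2 v 0) (nth 3 v 0)).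

Lemma turing_le_computable1 x o : turing_le x o <-> computable1 o (nat_of x).
Proof.
  split; intros [c Hc]; exists c.
  - intros [|k [|]] Hv; try discriminate; apply Hc.
  - intros k; apply (Hc [k] eq_refl).
Qed.

Section Closure.
Variable o : real.

Lemma computable_ext n F G :
  (forall v, length v = n -> F v = G v) -> computable o n F -> computable o n G.
Proof. intros FG [c Hc]; exists c; intros v Hv; rewrite <- FG; auto. Qed.

Lemma computable_nth n i : i < n -> computable o n (fun v => nth i v 0).
Proof. intros Hi; exists (Proj i); intros v Hv; constructor; lia. Qed.

Lemma computable_nth_skipn n k i (L : list nat -> list nat) :
  computable o n (fun v => nth (k + i) (L v) 0) ->
  computable o n (fun v => nth i (skipn k (L v)) 0).
Proof. apply computable_ext; intros v _; now rewrite nth_skipn. Qed.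

Lemma computable_comp m n F (Gs : list (list nat -> nat)) :
  computable o m F -> length Gs = m -> Forall (computable o n) Gs ->
  computable o n (fun v => F (map (fun G => G v) Gs)).
Proof.
  intros [c Hc] Hm HGs.
  assert (exists ds, forall v, length v = n -> evals o ds v (map (fun G => G v) Gs))
    as [ds Hds].
  { clear Hm; induction HGs as [|G Gs [d Hd] _ [ds Hds]].
    - exists []; intros v _; constructor.
    - exists (d :: ds); intros v Hv; constructor; auto. }
  exists (Comp c ds); intros v Hv.
  econstructor; [ apply Hds, Hv | apply Hc; now rewrite length_map ].
Qed.

Lemma computable_app1 f n F :
  computable1 o f -> computable o n F -> computable o n (fun v => f (F v)).
Proof. intros; apply (computable_comp 1 n (fun v => f (nth 0 v 0)) [F]); auto. Qed.

Lemma computable_app2 f n F G :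
  computable2 o f -> computable o n F -> computable o n G ->
  computable o n (fun v => f (F v) (G v)).
Proof.
  intros; apply (computable_comp 2 n (fun v => f (nth 0 v 0) (nth 1 v 0)) [F; G]); auto.
Qed.

Lemma computable_app3 f n F G H :
  computable3 o f -> computable o n F -> computable o n G -> computable o n H ->
  computable o n (fun v => f (F v) (G v) (H v)).
Proof.
  intros; apply (computable_comp 3 n
    (fun v => f (nth 0 v 0) (nth 1 v 0) (nth 2 v 0)) [F; G; H]); auto.
Qed.

Lemma computable_app4 f n F G H K :
  computable4 o f -> computable o n F -> computable o n G -> computable o n H ->
  computable o n K -> computable o n (fun v => f (F v) (G v) (H v) (K v)).
Proof.
  intros; apply (computable_comp 4 n
    (fun v => f (nth 0 v 0) (nth 1 v 0) (nth 2 v 0) (nth 3 v 0)) [F; G; H; K]); auto.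
Qed.

Lemma computable_succ : computable1 o S.
Proof. exists Succ; intros [|a [|]] Hv; try discriminate; constructor. Qed.

Lemma computable_const n k : computable o n (fun _ => k).
Proof.
  induction k as [|k IH].
  - exists Zero; intros; constructor.
  - apply (computable_app1 S); [ exact computable_succ | exact IH ].
Qed.

Lemma evals_proj_app u v :
  evals o (map Proj (seq (length u) (length v))) (u ++ v) v.
Proof.
  revert u; induction v as [|a v IH]; intros u; simpl; constructor.
  - replace a with (nth (length u) (u ++ a :: v) 0) at 2
      by (rewrite app_nth2, Nat.sub_diag; auto).
    constructor; rewrite length_app; simpl; lia.
  - specialize (IH (u ++ [a])).
    rewrite length_app, <- app_assoc, Nat.add_comm in IH; exact IH.
Qed.

Lemma evals_proj_skipn k n v :
  length v = k + n -> evals o (map Proj (seq k n)) v (skipn k v).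
Proof.
  intros Hv; pose proof (evals_proj_app (firstn k v) (skipn k v)) as E.
  rewrite firstn_skipn, length_firstn, length_skipn, Hv in E.
  replace (Nat.min k (k + n)) with k in E by lia.
  now replace (k + n - k) with n in E by lia.
Qed.

Lemma computable_subst k n (p : list nat -> nat -> nat) G :
  computable o (S n) (fun w => p (skipn 1 w) (nth 0 w 0)) -> computable o (k + n) G ->
  computable o (k + n) (fun w => p (skipn k w) (G w)).
Proof.
  intros [c Hc] [d Hd]; exists (Comp c (d :: map Proj (seq k n))); intros v Hv.
  econstructor.
  - constructor; [ apply Hd, Hv | apply evals_proj_skipn, Hv ].
  - apply (Hc (G v :: skipn k v)); simpl; rewrite length_skipn; lia.
Qed.

Lemma computable_rec n N F (g : list nat -> nat -> nat -> nat) :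
  computable o n N -> computable o n F ->
  computable o (2 + n) (fun w => g (skipn 2 w) (nth 0 w 0) (nth 1 w 0)) ->
  computable o n (fun v => nat_rect (fun _ => nat) (F v) (g v) (N v)).
Proof.
  intros [cN HN] [cF HF] [cG HG].
  exists (Comp (Prec cF cG) (cN :: map Proj (seq 0 n))); intros v Hv.
  econstructor.
  - constructor; [ apply HN, Hv | apply evals_proj_skipn, Hv ].
  - induction (N v) as [|m IH]; simpl; econstructor; eauto.
    apply (HG (m :: _ :: v)); simpl; lia.
Qed.

End Closure.

Create HintDb computable.
#[local] Hint Resolve computable_succ : computable.

Ltac computability_step :=
  match goal with
  | |- computable _ _ (fun _ => _) => apply computable_const
  | |- computable _ _ (fun v => nth _ v 0) => apply computable_nth; simpl; lia
  | |- computable _ _ (fun v => nth ?i (skipn ?k (@?L v)) 0) =>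
      apply (computable_nth_skipn _ _ k i L)
  | |- computable ?o _ (fun v => nat_of (?Z (@?F v)) (@?G v)) =>
      apply (computable_app2 o (fun i => nat_of (Z i)) _ F G);
      [ solve [ auto with computable ] | | ]
  | |- computable _ _ (fun v => ?f (@?F v)) =>
      apply (computable_app1 _ f _ F); [ solve [ auto with computable ] | ]
  | |- computable _ _ (fun v => ?f (@?F v) (@?G v)) =>
      apply (computable_app2 _ f _ F G); [ solve [ auto with computable ] | | ]
  | |- computable _ _ (fun v => ?f (@?F v) (@?G v) (@?H v)) =>
      apply (computable_app3 _ f _ F G H); [ solve [ auto with computable ] | | | ]
  | |- computable _ _ (fun v => ?f (@?F v) (@?G v) (@?H v) (@?K v)) =>
      apply (computable_app4 _ f _ F G H K); [ solve [ auto with computable ] | | | | ]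
  end.

Ltac computability :=
  unfold computable1, computable2, computable3, computable4;
  repeat (cbv beta; computability_step).

(* Decidable predicates are coded by natural numbers, with 0 for truth: conjunction is then
   [+], disjunction is [*], and a test can be fed directly to [Mu]. *)
Definition ifz (c a b : nat) : nat := nat_rect (fun _ => nat) a (fun _ _ => b) c.
Definition dist (a b : nat) : nat := (a - b) + (b - a).

Lemma dist_eq0 a b : dist a b = 0 <-> a = b.
Proof. unfold dist; lia. Qed.

Lemma computable_add o : computable2 o Nat.add.
Proof.
  apply computable_ext with
    (F := fun v => nat_rect (fun _ => nat) (nth 1 v 0) (fun _ r => S r) (nth 0 v 0)).
  - intros v _; induction (nth 0 v 0); simpl; auto.
  - apply (computable_rec o 2 _ _ (fun _ _ r => S r)); computability.
Qed.

Lemma computable_pred o : computable1 o pred.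
Proof.
  apply computable_ext with
    (F := fun v => nat_rect (fun _ => nat) 0 (fun m _ => m) (nth 0 v 0)).
  - intros v _; destruct (nth 0 v 0); reflexivity.
  - apply (computable_rec o 1 _ _ (fun _ m _ => m)); computability.
Qed.
#[local] Hint Resolve computable_add computable_pred : computable.

Lemma computable_sub o : computable2 o Nat.sub.
Proof.
  apply computable_ext with
    (F := fun v => nat_rect (fun _ => nat) (nth 0 v 0) (fun _ r => pred r) (nth 1 v 0)).
  - intros v _; induction (nth 1 v 0); simpl; lia.
  - apply (computable_rec o 2 _ _ (fun _ _ r => pred r)); computability.
Qed.

Lemma computable_mul o : computable2 o Nat.mul.
Proof.
  apply computable_ext with
    (F := fun v => nat_rect (fun _ => nat) 0 (fun _ r => nth 1 v 0 + r) (nth 0 v 0)).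
  - intros v _; induction (nth 0 v 0); simpl; lia.
  - apply (computable_rec o 2 _ _ (fun v _ r => nth 1 v 0 + r)); computability.
Qed.
#[local] Hint Resolve computable_sub computable_mul : computable.

Lemma computable_ifz o : computable3 o ifz.
Proof. apply (computable_rec o 3 _ _ (fun v _ _ => nth 2 v 0)); computability. Qed.
#[local] Hint Resolve computable_ifz : computable.

Lemma computable_dist o : computable2 o dist.
Proof. unfold dist; computability. Qed.
#[local] Hint Resolve computable_dist : computable.

Lemma computable_iter o n N f F :
  computable1 o f -> computable o n N -> computable o n F ->
  computable o n (fun v => Nat.iter (N v) f (F v)).
Proof.
  intros; apply (computable_rec o n _ _ (fun _ _ r => f r)); auto.
  apply computable_app1; [ assumption | computability ].
Qed.

Lemma mod_succ i m :
  m <> 0 -> S i mod m = ifz (m - S (i mod m)) 0 (S (i mod m)).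
Proof.
  intros Hm; pose proof (Nat.mod_upper_bound i m Hm).
  pose proof (Nat.div_mod i m Hm); symmetry.
  destruct (m - S (i mod m)) as [|d] eqn:E; simpl.
  - apply Nat.mod_unique with (S (i / m)); lia.
  - apply Nat.mod_unique with (i / m); lia.
Qed.

Lemma mod_add_neq d i m : 0 < d < m -> (d + i) mod m <> i mod m.
Proof.
  intros Hd E; pose proof (Nat.div_mod_eq (d + i) m); pose proof (Nat.div_mod_eq i m).
  destruct (Nat.le_gt_cases ((d + i) / m) (i / m)); nia.
Qed.

Lemma computable_mod o m : m <> 0 -> computable1 o (fun i => i mod m).
Proof.
  intros Hm; apply computable_ext with
    (F := fun v =>
       nat_rect (fun _ => nat) 0 (fun _ r => ifz (m - S r) 0 (S r)) (nth 0 v 0)).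
  - intros v _; induction (nth 0 v 0) as [|i IH].
    + symmetry; now apply Nat.Div0.mod_0_l.
    + now rewrite mod_succ, <- IH by auto.
  - apply (computable_rec o 1 _ _ (fun _ _ r => ifz (m - S r) 0 (S r))); computability.
Qed.

Lemma computable_cases o n m J (F : nat -> list nat -> nat) :
  computable o n J -> (forall j, computable o n (F j)) ->
  (forall j v, m <= j -> F j v = F m v) -> computable o n (fun v => F (J v) v).
Proof.
  revert J F; induction m as [|m IH]; intros J F HJ HF Hm.
  - apply computable_ext with (F 0); auto.
    intros v _; symmetry; apply Hm; lia.
  - apply computable_ext with
      (F := fun v => ifz (J v) (F 0 v) (F (S (pred (J v))) v)).
    + intros v _; destruct (J v); reflexivity.
    + apply (computable_app3 o ifz); [ auto with computable | auto | auto | ].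
      apply (IH (fun v => pred (J v)) (fun j => F (S j))); [ computability; auto | auto | ].
      intros j v Hj; apply Hm; lia.
Qed.

Lemma computable_periodic o (F : nat -> nat -> nat) m :
  m <> 0 -> (forall r, r < m -> computable1 o (F r)) ->
  computable2 o (fun i k => F (i mod m) k).
Proof.
  intros Hm HF; pose proof (computable_mod o m Hm).
  set (clamped := fun j v => F (Nat.min j (pred m)) (nth 1 v 0)).
  apply computable_ext with (F := fun v => clamped (nth 0 v 0 mod m) v).
  - intros v _; unfold clamped; pose proof (Nat.mod_upper_bound (nth 0 v 0) m Hm).
    now rewrite Nat.min_l by lia.
  - apply (computable_cases o 2 (pred m) (fun v => nth 0 v 0 mod m) clamped).
    + apply (computable_app1 o (fun i => i mod m)); [ assumption | computability ].
    + intros j; apply computable_app1; [ apply HF; lia | computability ].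
    + intros j v Hj; unfold clamped; now rewrite Nat.min_r, Nat.min_id.
Qed.

(** * Bounded and unbounded search *)

Definition fold_below (op : nat -> nat -> nat) (a t : nat) (p : nat -> nat) : nat :=
  nat_rect (fun _ => nat) a (fun m r => op r (p m)) t.
Notation sum_below := (fold_below Nat.add 0).
Notation prod_below := (fold_below Nat.mul 1).
(* The value is [n] if [p] has no zero below [n]. *)
Definition least_zero_below (p : nat -> nat) (n : nat) : nat :=
  nat_rect (fun _ => nat) 0 (fun m r => ifz (p r) r (S m)) n.

Lemma sum_below_eq0 t p : sum_below t p = 0 <-> forall k, k < t -> p k = 0.
Proof.
  induction t as [|t IH]; [ split; [ lia | reflexivity ] | ].
  change (sum_below (S t) p) with (sum_below t p + p t); rewrite Nat.eq_add_0, IH; split.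
  - intros [Hlt Ht] k Hk; destruct (Nat.eq_dec k t) as [->|]; [ auto | apply Hlt; lia ].
  - auto.
Qed.

Lemma prod_below_eq0 t p : prod_below t p = 0 <-> exists k, k < t /\ p k = 0.
Proof.
  induction t as [|t IH]; [ split; [ discriminate | intros (k & Hk & _); lia ] | ].
  change (prod_below (S t) p) with (prod_below t p * p t); rewrite Nat.mul_eq_0, IH; split.
  - intros [(k & Hk & E)|E]; eauto.
  - intros (k & Hk & E); destruct (Nat.eq_dec k t) as [->|]; auto.
    left; exists k; split; auto; lia.
Qed.

Lemma fold_below_ext op a t p q :
  (forall k, k < t -> p k = q k) -> fold_below op a t p = fold_below op a t q.
Proof.
  intros E; induction t as [|t IH]; [ reflexivity | ].
  change (op (fold_below op a t p) (p t) = op (fold_below op a t q) (q t)).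
  rewrite IH, E; auto.
Qed.

Lemma least_zero_below_succ p n :
  least_zero_below p (S n) = ifz (p (least_zero_below p n)) (least_zero_below p n) (S n).
Proof. reflexivity. Qed.

Lemma least_zero_below_ext p q n :
  (forall k, p k = q k) -> least_zero_below p n = least_zero_below q n.
Proof.
  intros E; induction n as [|n IH]; [ reflexivity | ].
  now rewrite !least_zero_below_succ, IH, E.
Qed.

Definition least (Q : nat -> Prop) (n : nat) : Prop := Q n /\ forall m, Q m -> n <= m.

Lemma exists_least (Q : nat -> Prop) : (exists n, Q n) -> exists n, least Q n.
Proof.
  intros HQ.
  destruct (dec_inh_nat_subset_has_unique_least_element Q (fun n => classic (Q n)) HQ)
    as (n & Hn & _); eauto.
Qed.

Lemma least_zero_below_eq p n e :
  e <= n -> least (fun m => p m = 0) e -> least_zero_below p n = e.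
Proof.
  intros He [He0 Hmin].
  assert (bound : forall m, least_zero_below p m <= m).
  { induction m as [|m IH]; [ auto | ].
    rewrite least_zero_below_succ; destruct (p (least_zero_below p m)); simpl; lia. }
  induction n as [|n IH]; [ simpl; lia | ].
  rewrite least_zero_below_succ; destruct (Nat.eq_dec e (S n)) as [->|].
  - destruct (p (least_zero_below p n)) eqn:E; [ | reflexivity ].
    apply Hmin in E; specialize (bound n); lia.
  - rewrite IH, He0 by lia; reflexivity.
Qed.

Section Search.
Variable o : real.

Lemma computable_fold_below op a n T p :
  computable2 o op -> computable o n T ->
  computable o (S n) (fun w => p (skipn 1 w) (nth 0 w 0)) ->
  computable o n (fun v => fold_below op a (T v) (p v)).
Proof.
  intros Hop HT Hp; apply (computable_rec o n _ _ (fun v m r => op r (p v m))); auto;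
    computability.
  apply (computable_subst o 2); [ exact Hp | computability ].
Qed.

Lemma computable_least_zero_below n T p :
  computable o n T -> computable o (S n) (fun w => p (skipn 1 w) (nth 0 w 0)) ->
  computable o n (fun v => least_zero_below (p v) (T v)).
Proof.
  intros HT Hp; apply (computable_rec o n _ _ (fun v m r => ifz (p v r) r (S m))); auto;
    computability.
  apply (computable_subst o 2); [ exact Hp | computability ].
Qed.

Lemma eval_search n (R : list nat -> nat) :
  computable o (S n) R ->
  exists c, forall v u, length v = n -> least (fun m => R (m :: v) = 0) u -> eval o c v u.
Proof.
  intros [c Hc]; exists (Mu c); intros v u Hv [Hu Hmin]; constructor.
  - rewrite <- Hu; apply Hc; simpl; lia.
  - intros m Hm; exists (pred (R (m :: v))).
    assert (R (m :: v) <> 0) by (intros E; apply Hmin in E; lia).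
    replace (S _) with (R (m :: v)) by lia; apply Hc; simpl; lia.
Qed.

Lemma computable_orbit (p : nat -> nat) :
  (exists c, forall i, eval o c [i; p i] (p (S i))) -> computable1 o p.
Proof.
  intros [c Hc]; destruct (computable_const o 0 (p 0)) as [d Hd].
  exists (Prec d c); intros [|i [|]] Hv; try discriminate; simpl; clear Hv.
  induction i as [|i IH]; econstructor; eauto.
Qed.

End Search.

Ltac computability_iteration_step :=
  match goal with
  | |- computable _ _ (fun v => Nat.iter (@?N v) ?f (@?F v)) =>
      apply (computable_iter _ _ N f F); [ solve [ auto with computable ] | | ]
  | |- computable _ _ (fun v => fold_below ?op ?a (@?T v) (@?p v)) =>
      apply (computable_fold_below _ op a _ T p); [ solve [ auto with computable ] | | ]
  | |- computable _ _ (fun v => least_zero_below (@?p v) (@?T v)) =>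
      apply (computable_least_zero_below _ _ T p)
  end.

Ltac computability ::=
  unfold computable1, computable2, computable3, computable4;
  repeat (cbv beta; first [ computability_step | computability_iteration_step ]).

(** * Coding of pairs and lists *)

Definition npair (a b : nat) : nat := Cantor.to_nat (a, b).
Definition nfst (n : nat) : nat := fst (Cantor.of_nat n).
Definition nsnd (n : nat) : nat := snd (Cantor.of_nat n).

Lemma nfst_npair a b : nfst (npair a b) = a.
Proof. unfold nfst, npair; now rewrite Cantor.cancel_of_to. Qed.
Lemma nsnd_npair a b : nsnd (npair a b) = b.
Proof. unfold nsnd, npair; now rewrite Cantor.cancel_of_to. Qed.
Lemma npair_eta n : npair (nfst n) (nsnd n) = n.
Proof.
  unfold nfst, nsnd, npair; now rewrite <- surjective_pairing, Cantor.cancel_to_of.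
Qed.

Lemma npair_ge a b : a <= npair a b /\ b <= npair a b.
Proof. pose proof (Cantor.to_nat_non_decreasing a b); unfold npair; lia. Qed.

Lemma npair_proj_le n : nfst n <= n /\ nsnd n <= n.
Proof. rewrite <- (npair_eta n) at 2 4; apply npair_ge. Qed.

Lemma computable_npair o : computable2 o npair.
Proof.
  apply computable_ext with
    (F := fun v => nth 1 v 0 + sum_below (nth 1 v 0 + nth 0 v 0) S).
  - intros v _; unfold npair; simpl; f_equal.
    induction (nth 1 v 0 + nth 0 v 0) as [|m IH]; [ reflexivity | ].
    simpl in *; rewrite <- IH; lia.
  - computability.
Qed.
#[local] Hint Resolve computable_npair : computable.

Lemma computable_bounded_solution o (R : nat -> nat -> nat) F :
  computable2 o R -> (forall n, F n <= n) -> (forall a n, R a n = 0 <-> a = F n) ->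
  computable1 o F.
Proof.
  intros HR Hle HF; apply computable_ext with
    (F := fun v => least_zero_below (fun a => R a (nth 0 v 0)) (nth 0 v 0)).
  - intros v _; apply least_zero_below_eq; [ apply Hle | split ].
    + now apply HF.
    + intros m Hm; apply HF in Hm; lia.
  - computability.
Qed.

Lemma computable_nfst o : computable1 o nfst.
Proof.
  apply computable_bounded_solution with
    (R := fun a n => prod_below (S n) (fun b => dist (npair a b) n)).
  - computability.
  - apply npair_proj_le.
  - intros a n; rewrite prod_below_eq0; setoid_rewrite dist_eq0; split.
    + intros (b & _ & <-); now rewrite nfst_npair.
    + intros ->; exists (nsnd n); pose proof (npair_proj_le n); rewrite npair_eta; lia.
Qed.

Lemma computable_nsnd o : computable1 o nsnd.
Proof.
  apply computable_bounded_solution with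
    (R := fun b n => prod_below (S n) (fun a => dist (npair a b) n)).
  - computability.
  - apply npair_proj_le.
  - intros b n; rewrite prod_below_eq0; setoid_rewrite dist_eq0; split.
    + intros (a & _ & <-); now rewrite nsnd_npair.
    + intros ->; exists (nfst n); pose proof (npair_proj_le n); rewrite npair_eta; lia.
Qed.
#[local] Hint Resolve computable_nfst computable_nsnd : computable.

Definition ncons (a l : nat) : nat := S (npair a l).
Definition nhead (l : nat) : nat := nfst (pred l).
Definition ntail (l : nat) : nat := nsnd (pred l).
Definition encode_list (v : list nat) : nat := fold_right ncons 0 v.

Lemma nhead_ncons a l : nhead (ncons a l) = a.
Proof. apply nfst_npair. Qed.
Lemma ntail_ncons a l : ntail (ncons a l) = l.
Proof. apply nsnd_npair. Qed.

Lemma encode_list_inj v w : encode_list v = encode_list w -> v = w.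
Proof.
  revert w; induction v as [|a v IH]; intros [|b w] E; try discriminate; auto.
  simpl in E; f_equal.
  - now rewrite <- (nhead_ncons a (encode_list v)), E, nhead_ncons.
  - apply IH; now rewrite <- (ntail_ncons a (encode_list v)), E, ntail_ncons.
Qed.

Lemma nth_encode_list i v :
  nhead (Nat.iter i ntail (encode_list v)) = nth i v 0.
Proof.
  revert v; induction i as [|i IH]; intros v.
  - destruct v; [ reflexivity | apply nhead_ncons ].
  - rewrite Nat.iter_succ_r; destruct v as [|a v]; simpl.
    + change (ntail 0) with (encode_list []); rewrite IH; now destruct i.
    + now rewrite ntail_ncons.
Qed.

Lemma computable_ncons o : computable2 o ncons.
Proof. unfold ncons; computability. Qed.
Lemma computable_nhead o : computable1 o nhead.
Proof. unfold nhead; computability. Qed.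
Lemma computable_ntail o : computable1 o ntail.
Proof. unfold ntail; computability. Qed.
#[local] Hint Resolve computable_ncons computable_nhead computable_ntail : computable.

(** * A universal machine *)

Lemma code_nested_ind (P : code -> Prop) :
  P Zero -> P Succ -> (forall i, P (Proj i)) -> P Orc ->
  (forall f gs, P f -> Forall P gs -> P (Comp f gs)) ->
  (forall f g, P f -> P g -> P (Prec f g)) -> (forall f, P f -> P (Mu f)) ->
  forall c, P c.
Proof.
  intros HZ HS HP HO HC HR HM; fix IH 1; intros [| |i| |f gs|f g|f];
    [ exact HZ | exact HS | apply HP | exact HO | | apply HR; apply IH | apply HM, IH ].
  apply HC; [ apply IH | ].
  induction gs as [|g gs IHgs]; constructor; [ apply IH | exact IHgs ].
Qed.

(* An instruction is a pair of an operation number and an argument. The numbers from 8 on are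
   continuations, which act on the value last computed. *)
Definition call (f : nat) : nat := npair 8 f.
Definition eval_rest (gs : nat) : nat := npair 9 gs.
Definition prepend (y : nat) : nat := npair 10 y.
Definition rec_step (g : nat) : nat := npair 11 g.
Definition mu_test (f : nat) : nat := npair 12 f.

Definition eval_all (es : list nat) : nat :=
  fold_right (fun e rest => npair 7 (npair e rest)) (npair 0 0) es.

Fixpoint encode (c : code) : nat :=
  match c with
  | Zero => npair 0 0
  | Succ => npair 1 0
  | Proj i => npair 2 i
  | Orc => npair 3 0
  | Comp f gs => npair 4 (npair (encode f) (eval_all (map encode gs)))
  | Prec f g => npair 5 (npair (encode f) (encode g))
  | Mu f => npair 6 (encode f)
  end.

(* The value [h e k s] is [S y] if program [e] halts on [k] within [s] steps with value [y],
   and 0 if it is still running. *)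
Definition persistent (h : nat -> nat -> nat -> nat) : Prop :=
  forall e k s s' y, h e k s = S y -> s <= s' -> h e k s' = S y.

Definition index_of (h : nat -> nat -> nat -> nat) (x : real) (e : nat) : Prop :=
  forall k, exists s, h e k s = S (nat_of x k).

Lemma persistent_unique h {e k s s' y y'} :
  persistent h -> h e k s = S y -> h e k s' = S y' -> y = y'.
Proof.
  intros Hh Hy Hy'; apply (Hh _ _ _ (s + s')) in Hy, Hy'; try lia; congruence.
Qed.

Lemma turing_le_index o h x e :
  computable3 o h -> persistent h -> index_of h x e -> turing_le x o.
Proof.
  intros Hh Hpers He; apply turing_le_computable1.
  assert (Hs : forall k, exists s, least (fun s => 1 - h e k s = 0) s).
  { intros k; apply exists_least; destruct (He k) as [s Hs]; exists s; lia. }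
  apply functional_choice in Hs; destruct Hs as [s Hs].
  assert (computable1 o s).
  { destruct (eval_search o 1 (fun v => 1 - h e (nth 1 v 0) (nth 0 v 0))) as [c Hc];
      [ computability | ].
    exists c; intros [|k [|]] Hv; try discriminate; apply Hc; auto; apply Hs. }
  apply computable_ext with (F := fun v => pred (h e (nth 0 v 0) (s (nth 0 v 0)))).
  - intros v _; destruct (Hs (nth 0 v 0)) as [Hhalt _], (He (nth 0 v 0)) as [s' Hs'].
    destruct (h e (nth 0 v 0) (s (nth 0 v 0))) as [|y] eqn:Hy; [ discriminate | ].
    exact (persistent_unique h Hpers Hy Hs').
  - computability.
Qed.

Section Machine.
Variable X : real.

Definition push (instr env stack : nat) : nat := ncons (npair instr env) stack.

(* A configuration is the pair of the value last computed, here [y], and a stack of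
   instructions, each with the coded list [v] of its arguments. *)
Definition execute (op arg v config : nat) : nat :=
  let y := nfst config in
  let K := nsnd config in
  match op with
  | 0 => npair 0 K
  | 1 => npair (S (nhead v)) K
  | 2 => npair (nhead (Nat.iter arg ntail v)) K
  | 3 => npair (nat_of X (nhead v)) K
  | 4 => npair y (push (nsnd arg) v (push (call (nfst arg)) 0 K))
  | 5 => ifz (nhead v)
           (npair y (push (nfst arg) (ntail v) K))
           (npair y (push (npair 5 arg) (ncons (pred (nhead v)) (ntail v))
              (push (rec_step (nsnd arg)) (ncons (pred (nhead v)) (ntail v)) K)))
  | 6 => npair y (push arg (ncons 0 v) (push (mu_test arg) (ncons 0 v) K))
  | 7 => npair y (push (nfst arg) v (push (eval_rest (nsnd arg)) v K))
  | 8 => npair y (push arg y K)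
  | 9 => npair y (push arg v (push (prepend y) 0 K))
  | 10 => npair (ncons arg y) K
  | 11 => npair y (push arg (ncons (nhead v) (ncons y (ntail v))) K)
  | _ => ifz y (npair (nhead v) K)
           (npair y (push arg (ncons (S (nhead v)) (ntail v))
              (push (mu_test arg) (ncons (S (nhead v)) (ntail v)) K)))
  end.

Definition step (config : nat) : nat :=
  ifz (nsnd config) config
    (execute (nfst (nfst (nhead (nsnd config)))) (nsnd (nfst (nhead (nsnd config))))
       (nsnd (nhead (nsnd config))) (npair (nfst config) (ntail (nsnd config)))).

Lemma step_push op arg v y K :
  step (npair y (push (npair op arg) v K)) = execute op arg v (npair y K).
Proof.
  unfold step; rewrite nfst_npair, nsnd_npair; unfold push.
  rewrite nhead_ncons, ntail_ncons, nfst_npair, nsnd_npair, nfst_npair, nsnd_npair.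
  reflexivity.
Qed.

Definition reaches (a b : nat) : Prop := exists n, Nat.iter n step a = b.

Lemma reaches_refl a : reaches a a.
Proof. now exists 0. Qed.

Lemma reaches_trans a b c : reaches a b -> reaches b c -> reaches a c.
Proof.
  intros [n Hn] [m Hm]; exists (m + n); now rewrite Nat.iter_add, Hn.
Qed.

Lemma reaches_push op arg v y K b :
  reaches (execute op arg v (npair y K)) b ->
  reaches (npair y (push (npair op arg) v K)) b.
Proof.
  rewrite <- step_push; intros [n Hn]; exists (S n); now rewrite Nat.iter_succ_r.
Qed.

Definition computes (instr v y : nat) : Prop :=
  forall y0 K, reaches (npair y0 (push instr v K)) (npair y K).

Definition simulated (c : code) : Prop :=
  forall v y, eval X c v y -> computes (encode c) (encode_list v) y.

Ltac execute_top :=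
  apply reaches_push; cbn [execute];
  rewrite ?nfst_npair, ?nsnd_npair, ?nhead_ncons, ?ntail_ncons, ?nfst_npair, ?nsnd_npair;
  cbn [ifz nat_rect pred].

Lemma computes_eval_all gs :
  Forall simulated gs ->
  forall v ys, evals X gs v ys ->
    computes (eval_all (map encode gs)) (encode_list v) (encode_list ys).
Proof.
  induction 1 as [|g gs Hg _ IH]; intros v ys Hys y0 K;
    inversion Hys as [|? ? ? y ys' Hy Hys']; subst; cbn [eval_all map fold_right].
  - execute_top; apply reaches_refl.
  - execute_top; eapply reaches_trans; [ apply Hg, Hy | ].
    execute_top; eapply reaches_trans; [ apply IH, Hys' | ].
    execute_top; apply reaches_refl.
Qed.

Lemma simulated_prec f g : simulated f -> simulated g -> simulated (Prec f g).
Proof.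
  intros Hf Hg v y Hy.
  assert (exists n v', v = n :: v') as (n & v' & ->) by (inversion Hy; eauto).
  revert y Hy; induction n as [|n IH]; intros y Hy y0 K;
    inversion Hy as [| | | | |? ? ? ? Hz|? ? ? ? r ? Hr Hs|]; subst;
    cbn [encode encode_list fold_right].
  - execute_top; now apply Hf.
  - execute_top; eapply reaches_trans; [ apply (IH r Hr) | ].
    execute_top; apply (Hg (n :: r :: v') y Hs).
Qed.

Lemma simulated_mu f : simulated f -> simulated (Mu f).
Proof.
  intros Hf v n Hn; inversion Hn as [| | | | | | |? ? ? Hzero Hpos]; subst.
  assert (search : forall d m y0 K, m + d = n -> reaches
    (npair y0 (push (encode f) (encode_list (m :: v))
                 (push (mu_test (encode f)) (encode_list (m :: v)) K)))
    (npair n K)).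
  { induction d as [|d IH]; intros m y0 K Hm.
    - replace m with n by lia; eapply reaches_trans; [ apply Hf, Hzero | ].
      cbn [encode_list fold_right]; execute_top; apply reaches_refl.
    - destruct (Hpos m) as [k Hk]; [ lia | ].
      eapply reaches_trans; [ apply Hf, Hk | ].
      cbn [encode_list fold_right]; execute_top; apply (IH (S m)); lia. }
  intros y0 K; cbn [encode]; execute_top; now apply (search n 0).
Qed.

Lemma simulated_code c : simulated c.
Proof.
  induction c as [| |i| |f gs IHf IHgs|f g IHf IHg|f IHf] using code_nested_ind.
  1-5: intros v y Hy y0 K; inversion Hy; subst; cbn [encode encode_list fold_right].
  - execute_top; apply reaches_refl.
  - execute_top; apply reaches_refl.
  - execute_top; rewrite nth_encode_list; apply reaches_refl.
  - execute_top; apply reaches_refl.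
  - execute_top; eapply reaches_trans; [ eapply computes_eval_all; eassumption | ].
    execute_top; apply IHf; assumption.
  - now apply simulated_prec.
  - now apply simulated_mu.
Qed.

Definition run (e k s : nat) : nat :=
  let config := Nat.iter s step (npair 0 (push e (encode_list [k]) 0)) in
  ifz (nsnd config) (S (nfst config)) 0.

Lemma run_persistent : persistent run.
Proof.
  intros e k s s' y Hy Hs; replace s' with ((s' - s) + s) by lia.
  unfold run in *; rewrite Nat.iter_add.
  set (config := Nat.iter s step _) in *.
  destruct (nsnd config) eqn:E; [ | discriminate ].
  replace (Nat.iter (s' - s) step config) with config; [ now rewrite E | ].
  induction (s' - s) as [|d IH]; simpl; auto.
  rewrite <- IH; unfold step; now rewrite E.
Qed.

Lemma run_complete x : turing_le x X -> exists e, index_of run x e.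
Proof.
  intros [c Hc]; exists (encode c); intros k.
  destruct (simulated_code c _ _ (Hc k) 0 0) as [s Hs]; exists s.
  unfold run; now rewrite Hs, nfst_npair, nsnd_npair.
Qed.

Lemma computable_execute o : turing_le X o -> computable4 o execute.
Proof.
  intros HX; apply turing_le_computable1 in HX.
  apply (computable_cases o 4 12 (fun w => nth 0 w 0)
    (fun op w => execute op (nth 1 w 0) (nth 2 w 0) (nth 3 w 0))).
  - computability.
  - intros op; unfold execute, push, call, eval_rest, prepend, rec_step, mu_test.
    do 12 (destruct op as [|op]; [ computability | ]); computability.
  - intros op w Hop; do 12 (destruct op as [|op]; [ lia | ]); reflexivity.
Qed.

Lemma computable_run o : turing_le X o -> computable3 o run.
Proof.
  intros HX; pose proof (computable_execute o HX).
  assert (computable1 o step) by (unfold step; computability).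
  unfold run, push; cbn [encode_list fold_right].
  computability.
Qed.

End Machine.

Lemma turing_le_trans x y z : turing_le x y -> turing_le y z -> turing_le x z.
Proof.
  intros Hxy Hyz; destruct (run_complete y x Hxy) as [e He].
  apply turing_le_index with (run y) e; auto using computable_run, run_persistent.
Qed.

(** * Coding into a perfect set *)

Definition eventually (Q : nat -> Prop) : Prop := exists n0, forall n, n0 <= n -> Q n.

Lemma eventually_and P Q :
  eventually P -> eventually Q -> eventually (fun n => P n /\ Q n).
Proof.
  intros [n0 HP] [n1 HQ]; exists (n0 + n1); intros n Hn.
  split; [ apply HP | apply HQ ]; lia.
Qed.

Lemma eventually_forall_bool (Q : bool -> nat -> Prop) :
  (forall d, eventually (Q d)) -> eventually (fun n => forall d, Q d n).
Proof.
  intros HQ; destruct (eventually_and _ _ (HQ true) (HQ false)) as [n0 Hn0].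
  exists n0; intros n Hn []; now apply Hn0.
Qed.

Lemma eventually_forall_below (Q : nat -> nat -> Prop) m :
  (forall k, k < m -> eventually (Q k)) ->
  eventually (fun n => forall k, k < m -> Q k n).
Proof.
  induction m as [|m IH]; intros HQ; [ exists 0; lia | ].
  destruct (eventually_and _ _ (IH ltac:(auto)) (HQ m ltac:(auto))) as [n0 Hn0].
  exists n0; intros n Hn k Hk; destruct (Nat.eq_dec k m) as [->|]; apply Hn0; lia.
Qed.

Lemma agree_upto_le m n x y : m <= n -> agree_upto n x y -> agree_upto m x y.
Proof. intros Hmn Hxy k Hk; apply Hxy; lia. Qed.

Lemma agree_upto_trans n x y z : agree_upto n x y -> agree_upto n y z -> agree_upto n x z.
Proof. intros Hxy Hyz k Hk; now rewrite Hxy, Hyz. Qed.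

Definition limit (x : nat -> real) : real := fun k => x (S k) k.

Section Limit.
Variables (x : nat -> real) (l : nat -> nat).
Hypothesis l_increasing : forall i, l i < l (S i).
Hypothesis x_agree : forall i, agree_upto (l i) (x i) (x (S i)).

Lemma strictly_increasing_ge i : i <= l i.
Proof. induction i as [|i IH]; [ lia | specialize (l_increasing i); lia ]. Qed.

Lemma agree_upto_later i d : l i <= l (d + i) /\ agree_upto (l i) (x i) (x (d + i)).
Proof.
  induction d as [|d [Hl Hx]]; [ split; [ auto | now intros k _ ] | ].
  specialize (l_increasing (d + i)); specialize (x_agree (d + i)); split; [ simpl; lia | ].
  apply agree_upto_trans with (x (d + i)); auto.
  now apply agree_upto_le with (l (d + i)).
Qed.

Lemma agree_upto_limit i : agree_upto (l i) (x i) (limit x).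
Proof.
  intros k Hk; unfold limit; destruct (Nat.le_gt_cases i (S k)).
  - replace (S k) with ((S k - i) + i) by lia; now apply agree_upto_later.
  - replace i with ((i - S k) + S k) by lia; symmetry; apply agree_upto_later.
    apply strictly_increasing_ge.
Qed.

Lemma closed_set_limit A : closed_set A -> (forall i, A (x i)) -> A (limit x).
Proof.
  intros HA Hx; apply HA; intros n; exists (x n); split; auto.
  intros k Hk; symmetry; apply agree_upto_limit; pose proof (strictly_increasing_ge n); lia.
Qed.

End Limit.

Lemma first_difference (x y : real) :
  x <> y -> exists m, agree_upto m x y /\ x m <> y m.
Proof.
  intros Hxy; destruct (exists_least (fun m => x m <> y m)) as (m & Hm & Hmin).
  - apply not_all_ex_not; intros E; apply Hxy, functional_extensionality, E.
  - exists m; split; auto; intros k Hk.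
    apply NNPP; intros Hne; apply Hmin in Hne; lia.
Qed.

Definition total (u : bool -> nat) : nat := u false + u true.

Section Coding.
(* [h] abstracts [run X] for a fixed oracle [X]. *)
Variable h : nat -> nat -> nat -> nat.

Definition tracks (e t s : nat) (x : real) : Prop :=
  forall k, k < t -> h e k s = S (nat_of x k).
Definition mismatch (e t s : nat) (x : real) : nat :=
  sum_below t (fun k => dist (h e k s) (S (nat_of x k))).

Definition guess (x : real) (t s : nat) : nat :=
  least_zero_below (fun e => mismatch e t s x) s.

(* Vanishes iff, within [u] steps, program [e] is seen to agree with [x] up to some [k < u]
   and to differ from it at [k]. *)
Definition departed (e : nat) (x : real) (u : nat) : nat :=
  prod_below u (fun k => mismatch e k u x + dist (h e k u) (S (1 - nat_of x k))).

Definition departs_at (x : real) (t s u : nat) : Prop :=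
  least (fun u' => departed (guess x t s) x u' = 0) u.

Lemma mismatch_eq0 e t s x : mismatch e t s x = 0 <-> tracks e t s x.
Proof. unfold mismatch; rewrite sum_below_eq0; now setoid_rewrite dist_eq0. Qed.

Lemma departed_eq0 e x u :
  departed e x u = 0 <->
  exists k, k < u /\ tracks e k u x /\ h e k u = S (1 - nat_of x k).
Proof.
  unfold departed; rewrite prod_below_eq0.
  now setoid_rewrite Nat.eq_add_0; setoid_rewrite mismatch_eq0; setoid_rewrite dist_eq0.
Qed.

Lemma mismatch_agree e t s x x' :
  agree_upto t x x' -> mismatch e t s x = mismatch e t s x'.
Proof. intros Hx; apply fold_below_ext; intros k Hk; unfold nat_of; now rewrite Hx. Qed.

Lemma guess_agree x x' t s : agree_upto t x x' -> guess x t s = guess x' t s.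
Proof. intros Hx; apply least_zero_below_ext; intros e; now apply mismatch_agree. Qed.

Lemma departed_agree e x x' u : agree_upto u x x' -> departed e x u = departed e x' u.
Proof.
  intros Hx; apply fold_below_ext; intros k Hk; unfold nat_of; rewrite (Hx k Hk).
  now rewrite (mismatch_agree e k u x x') by (apply agree_upto_le with u; auto; lia).
Qed.

Lemma departs_at_agree x x' t s u n :
  agree_upto n x x' -> t <= n -> u <= n -> departs_at x t s u -> departs_at x' t s u.
Proof.
  intros Hx Ht Hu [Hdep Hmin]; unfold departs_at.
  rewrite <- (guess_agree x x') by (now apply agree_upto_le with n).
  split.
  - rewrite <- (departed_agree _ x x'); auto; now apply agree_upto_le with n.
  - intros m Hm; destruct (Nat.le_gt_cases u m) as [|Hlt]; auto.
    apply Hmin; rewrite (departed_agree _ x x'); auto.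
    apply agree_upto_le with n; auto; lia.
Qed.

Definition departures_code (x : bool -> nat -> real) (u : nat -> bool -> nat) (y : real)
  : Prop :=
  forall i,
    (forall d, departs_at (x d i) (total (u i)) (total (u (S i))) (u (S (S i)) d)) /\
    y i = (u (S (S i)) false <? u (S (S i)) true).

Hypothesis h_persistent : persistent h.

Definition separates (t : nat) (x : real) : Prop :=
  exists e, index_of h x e /\ forall e' s, tracks e' t s x -> e <= e'.

Lemma separates_eventually x :
  (exists e, index_of h x e) -> eventually (fun t => separates t x).
Proof.
  intros Hx; destruct (exists_least _ Hx) as (e & He & Hmin).
  destruct (eventually_forall_below (fun e' t => forall s, ~ tracks e' t s x) e)
    as [t0 Ht0].
  - intros e' He'.
    destruct (not_all_ex_not _ (fun k => exists s, h e' k s = S (nat_of x k))) as [k Hk].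
    { intros He''; apply Hmin in He''; lia. }
    exists (S k); intros t Ht s Htr; apply Hk; exists s; apply Htr; lia.
  - exists t0; intros t Ht; exists e; split; auto.
    intros e' s Htr; apply Nat.nlt_ge; intros He'; exact (Ht0 t Ht e' He' s Htr).
Qed.

Lemma tracks_eventually x e t : index_of h x e -> eventually (fun s => tracks e t s x).
Proof.
  intros He; apply eventually_forall_below; intros k _.
  destruct (He k) as [s0 Hs0]; exists s0; intros s; now apply h_persistent.
Qed.

Lemma guess_eventually_index t x :
  separates t x -> eventually (fun s => index_of h x (guess x t s)).
Proof.
  intros (e & He & Hmin); destruct (tracks_eventually x e t He) as [s0 Hs0].
  exists (e + s0); intros s Hs; unfold guess.
  rewrite (least_zero_below_eq _ s e); auto; [ lia | split ].
  - apply mismatch_eq0, Hs0; lia.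
  - intros e' He'; apply mismatch_eq0 in He'; eauto.
Qed.

Lemma departure_exists x x' e n :
  index_of h x e -> agree_upto n x x' -> x n <> x' n ->
  exists u, n < u /\ least (fun u' => departed e x' u' = 0) u.
Proof.
  intros He Hag Hne.
  destruct (exists_least (fun u => departed e x' u = 0)) as (u & Hu & Hmin).
  - destruct (tracks_eventually x e (S n) He) as [s Hs].
    exists (S n + s); apply departed_eq0; exists n; repeat split; [ lia | | ].
    + intros k Hk; rewrite Hs by lia; unfold nat_of; now rewrite Hag.
    + rewrite Hs by lia; unfold nat_of; destruct (x n), (x' n); simpl; congruence.
  - exists u; split; [ | split; auto ].
    apply departed_eq0 in Hu; destruct Hu as (k & Hk & _ & Hrun).
    destruct (Nat.le_gt_cases n k) as [|Hlt]; [ lia | exfalso ].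
    destruct (He k) as [s Hs].
    pose proof (persistent_unique h h_persistent Hrun Hs) as E.
    unfold nat_of in E; rewrite Hag in E by auto; destruct (x' k); discriminate.
Qed.

Definition branching (b : nat -> real) : Prop :=
  forall i n, exists j m, n <= m /\ agree_upto m (b i) (b j) /\ b i m <> b j m.

Variable b : nat -> real.
Hypothesis b_branching : branching b.
Hypothesis b_index : forall i, exists e, index_of h (b i) e.

Lemma late_departure_exists i t s n :
  index_of h (b i) (guess (b i) t s) -> t <= n ->
  exists j u, n < u /\ agree_upto n (b i) (b j) /\ departs_at (b j) t s u.
Proof.
  intros He Ht; destruct (b_branching i n) as (j & m & Hm & Hag & Hne).
  destruct (departure_exists _ _ _ _ He Hag Hne) as (u & Hu & Hdep).
  exists j, u; split; [ lia | split; [ now apply agree_upto_le with m | ] ].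
  unfold departs_at; rewrite <- (guess_agree (b i)); auto.
  apply agree_upto_le with m; auto; lia.
Qed.

Lemma ordered_departures_exist (i : bool -> nat) t s n y :
  (forall d, index_of h (b (i d)) (guess (b (i d)) t s)) -> t <= n ->
  exists (j u : bool -> nat),
    (forall d,
       n < u d /\ agree_upto n (b (i d)) (b (j d)) /\ departs_at (b (j d)) t s (u d)) /\
    y = (u false <? u true).
Proof.
  intros He Ht.
  destruct (late_departure_exists (i (negb y)) t s n) as (j1 & u1 & Hu1 & Hag1 & Hdep1); auto.
  destruct (late_departure_exists (i y) t s u1) as (j2 & u2 & Hu2 & Hag2 & Hdep2);
    [ apply He | lia | ].
  exists (fun d => if Bool.eqb d y then j2 else j1),
    (fun d => if Bool.eqb d y then u2 else u1).
  split.
  - intros d; destruct (Bool.eqb_spec d y) as [->|Hd].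
    + split; [ lia | split; [ apply agree_upto_le with u1; auto; lia | exact Hdep2 ] ].
    + replace d with (negb y) by (destruct d, y; simpl; congruence); auto.
  - destruct y; symmetry; [ apply Nat.ltb_lt | apply Nat.ltb_ge ]; simpl; lia.
Qed.

(* A stage determines six reals, [b (target d r)] for [r < 3], of which the first
   [total newer] bits are final; those with [r = number mod 3] depart next, and [older] and
   [newer] are the last two pairs of departures. *)
Record stage := Stage
  { number : nat; target : bool -> nat -> nat; older : bool -> nat; newer : bool -> nat }.

Definition followed (st : stage) (d : bool) (r : nat) : real := b (target st d r).

Definition invariant (st : stage) : Prop :=
  total (older st) <= total (newer st) /\
  forall d,
    index_of h (followed st d (number st mod 3))
      (guess (followed st d (number st mod 3)) (total (older st)) (total (newer st))) /\
    separates (total (newer st)) (followed st d (S (number st) mod 3)).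

Definition transition (y : real) (st st' : stage) : Prop :=
  number st' = S (number st) /\ older st' = newer st /\
  total (newer st) < total (newer st') /\
  (forall d r, agree_upto (total (newer st)) (followed st d r) (followed st' d r)) /\
  (forall d, departs_at (followed st' d (number st mod 3))
               (total (older st)) (total (newer st)) (newer st' d)) /\
  y (number st) = (newer st' false <? newer st' true).

Lemma next_guess_eventually_index st :
  invariant st ->
  eventually (fun n => forall d,
    index_of h (followed st d (S (number st) mod 3))
      (guess (followed st d (S (number st) mod 3)) (total (newer st)) n) /\
    separates n (followed st d (S (S (number st)) mod 3))).
Proof.
  intros [_ Hinv]; apply eventually_forall_bool; intros d; apply eventually_and.
  - apply guess_eventually_index, Hinv.
  - apply separates_eventually, b_index.
Qed.

Lemma transition_exists y st :
  invariant st -> exists st', invariant st' /\ transition y st st'.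
Proof.
  intros Hinv; destruct (next_guess_eventually_index st Hinv) as [n0 Hready].
  destruct Hinv as [Hle Hinv]; set (r0 := number st mod 3).
  destruct (ordered_departures_exist (fun d => target st d r0) (total (older st))
              (total (newer st)) (total (newer st) + n0) (y (number st)))
    as (j & u & Hdep & Hy); [ apply Hinv | lia | ].
  set (st' := Stage (S (number st)) (fun d r => if r =? r0 then j d else target st d r)
                (newer st) u).
  assert (moved : forall d, followed st' d r0 = b (j d)).
  { intros d; unfold followed; simpl; now rewrite Nat.eqb_refl. }
  assert (kept : forall d r, r <> r0 -> followed st' d r = followed st d r).
  { intros d r Hr; unfold followed; simpl; now destruct (Nat.eqb_spec r r0). }
  assert (late : total (newer st) + n0 < total u).
  { unfold total; pose proof (proj1 (Hdep false)); unfold total in *; lia. }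
  exists st'; split; [ split | ].
  - simpl; lia.
  - intros d; change (number st') with (1 + number st).
    rewrite !kept by (apply (mod_add_neq 1) || apply (mod_add_neq 2); lia).
    apply Hready; simpl; lia.
  - split; [ reflexivity | split; [ reflexivity | split; [ simpl; lia | ] ] ].
    split; [ | split; [ | exact Hy ] ].
    + intros d r; destruct (Nat.eq_dec r r0) as [->|Hr]; [ | now rewrite kept ].
      rewrite moved; apply agree_upto_le with (total (newer st) + n0); [ lia | apply Hdep ].
    + intros d; fold r0; rewrite moved; apply Hdep.
Qed.

Lemma initial_stage_exists : exists st, number st = 0 /\ invariant st.
Proof.
  destruct (separates_eventually (b 0)) as [t0 Ht0]; [ apply b_index | ].
  destruct (guess_eventually_index t0 (b 0)) as [s0 Hs0]; [ now apply Ht0 | ].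
  exists (Stage 0 (fun _ _ => 0) (fun d => if d then t0 else 0)
            (fun d => if d then t0 + s0 else 0)).
  split; [ reflexivity | unfold invariant, total; simpl; split; [ lia | ] ].
  intros d; split; [ apply Hs0 | apply Ht0 ]; lia.
Qed.

Lemma stages_exist y :
  exists st : nat -> stage,
    forall i, number (st i) = i /\ invariant (st i) /\ transition y (st i) (st (S i)).
Proof.
  destruct initial_stage_exists as (st0 & Hnumber & Hinv0).
  destruct (functional_choice_imp_functional_dependent_choice functional_choice
              (fun st st' : {st | invariant st} =>
                 transition y (proj1_sig st) (proj1_sig st')))
    with (exist invariant st0 Hinv0) as (st & Hst0 & Hst).
  - intros [st Hst]; destruct (transition_exists y st Hst) as (st' & Hst' & Htr).
    now exists (exist invariant st' Hst').
  - exists (fun i => proj1_sig (st i)); intros i; split; [ | split; auto ].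
    + induction i as [|i IH]; [ now rewrite Hst0 | ].
      destruct (Hst i) as [-> _]; now rewrite IH.
    + apply (proj2_sig (st i)).
Qed.

Lemma coding_reals_exist (A : real -> Prop) y :
  closed_set A -> (forall i, A (b i)) ->
  exists (z : bool -> nat -> real) (u : nat -> bool -> nat),
    (forall d r, A (z d r)) /\ departures_code (fun d i => z d (i mod 3)) u y.
Proof.
  intros HA HbA; destruct (stages_exist y) as [st Hst].
  set (x := fun d r i => followed (st i) d r); set (l := fun i => total (newer (st i))).
  assert (increasing : forall i, l i < l (S i)) by (intros i; apply (Hst i)).
  assert (agree : forall d r i, agree_upto (l i) (x d r i) (x d r (S i))).
  { intros d r i; apply (Hst i). }
  exists (fun d r => limit (x d r)), (fun i => older (st i)); split.
  - intros d r; apply closed_set_limit with l; auto; intros i; apply HbA.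
  - intros i; destruct (Hst i) as (Hi & (Hle & _) & (_ & Eo & _ & _ & Hdep & Hy)).
    destruct (Hst (S i)) as (_ & _ & (_ & Eo' & _)); rewrite Hi in Hdep, Hy.
    rewrite Eo', Eo; split; auto; intros d.
    apply departs_at_agree with (x d (i mod 3) (S i)) (l (S i)).
    + now apply agree_upto_limit.
    + specialize (increasing i); unfold l in *; lia.
    + unfold l, total; destruct d; lia.
    + apply Hdep.
Qed.

End Coding.

Section Decoding.
Variables (o : real) (h : nat -> nat -> nat -> nat).
Hypothesis h_computable : computable3 o h.

Lemma computable_departed (x : nat -> real) :
  computable2 o (fun i => nat_of (x i)) ->
  computable4 o (fun u i t s => departed h (guess h (x i) t s) (x i) u).
Proof. intros; unfold departed, guess, mismatch; computability. Qed.

Lemma eval_departure (x : nat -> real) :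
  computable2 o (fun i => nat_of (x i)) ->
  exists c, forall i t s u, departs_at h (x i) t s u -> eval o c [i; npair t s] u.
Proof.
  intros Hx; pose proof (computable_departed x Hx) as Hdep.
  destruct (eval_search o 2 (fun v => (fun u i t s =>
      departed h (guess h (x i) t s) (x i) u)
      (nth 0 v 0) (nth 1 v 0) (nfst (nth 2 v 0)) (nsnd (nth 2 v 0)))) as [c Hc].
  - apply (computable_app4 o (fun u i t s => departed h (guess h (x i) t s) (x i) u));
      [ exact Hdep | computability.. ].
  - exists c; intros i t s u Hu; apply Hc; [ reflexivity | ].
    simpl; now rewrite nfst_npair, nsnd_npair.
Qed.

(* The searches for departures need not terminate in general, so the recursion is only
   evaluated along a sequence on which they do. *)
Lemma computable_departures (x : bool -> nat -> real) (u : nat -> bool -> nat) y :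
  (forall d, computable2 o (fun i => nat_of (x d i))) -> departures_code h x u y ->
  forall d, computable1 o (fun i => u (S (S i)) d).
Proof.
  intros Hx Hu; set (p := fun i => npair (total (u i)) (total (u (S i)))).
  assert (departure : forall d, exists c, forall i, eval o c [i; p i] (u (S (S i)) d)).
  { intros d; destruct (eval_departure (x d) (Hx d)) as [c Hc].
    exists c; intros i; apply Hc, Hu. }
  assert (Hp : computable1 o p).
  { apply computable_orbit.
    destruct (departure false) as [c0 Hc0], (departure true) as [c1 Hc1].
    assert (Hnext : computable3 o (fun q a b => npair (nsnd q) (a + b))) by computability.
    destruct Hnext as [c Hc]; exists (Comp c [Proj 1; c0; c1]); intros i.
    econstructor.
    - econstructor; [ constructor; simpl; lia | ].
      econstructor; [ apply Hc0 | econstructor; [ apply Hc1 | constructor ] ].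
    - unfold p at 2; rewrite <- (nsnd_npair (total (u i)) (total (u (S i)))) at 1.
      apply (Hc [_; _; _] eq_refl). }
  intros d; destruct (departure d) as [c Hc], Hp as [cp Hcp].
  exists (Comp c [Proj 0; cp]); intros [|i [|]] Hv; try discriminate.
  econstructor; [ | apply Hc ].
  econstructor; [ constructor; simpl; lia | ].
  econstructor; [ apply (Hcp [i] eq_refl) | constructor ].
Qed.

Lemma turing_le_departures_code (x : bool -> nat -> real) (u : nat -> bool -> nat) y :
  (forall d, computable2 o (fun i => nat_of (x d i))) ->
  departures_code h x u y -> turing_le y o.
Proof.
  intros Hx Hu; apply turing_le_computable1.
  assert (Hdep : forall d, computable1 o (fun i => u (S (S i)) d)).
  { now apply (computable_departures x u y). }
  apply computable_ext with
    (F := fun v => 1 - (S ((fun i => u (S (S i)) false) (nth 0 v 0))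
                        - (fun i => u (S (S i)) true) (nth 0 v 0))).
  - intros v _; unfold nat_of; rewrite (proj2 (Hu _)).
    destruct (Nat.ltb_spec (u (S (S (nth 0 v 0))) false) (u (S (S (nth 0 v 0))) true));
      simpl b2n; lia.
  - apply (computable_app2 o Nat.sub); [ apply computable_sub | computability | ].
    apply (computable_app2 o Nat.sub); [ apply computable_sub | | exact (Hdep true) ].
    apply (computable_app1 o S); [ apply computable_succ | exact (Hdep false) ].
Qed.

End Decoding.

Definition prefix_code (x : real) (n : nat) : nat := encode_list (map (nat_of x) (seq 0 n)).

Lemma prefix_code_inj x y n m :
  prefix_code x n = prefix_code y m -> n = m /\ agree_upto n x y.
Proof.
  intros E; apply encode_list_inj in E.
  assert (n = m) as <-.
  { apply (f_equal (@length nat)) in E; now rewrite !length_map, !length_seq in E. }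
  split; [ reflexivity | intros k Hk ].
  apply ext_in_map with (a := k) in E; [ | apply in_seq; lia ].
  unfold nat_of in E; destruct (x k), (y k); simpl in E; congruence.
Qed.

Definition dense_sequence (A : real -> Prop) (b : nat -> real) : Prop :=
  (forall i, A (b i)) /\ forall x n, A x -> exists i, agree_upto n x (b i).

Lemma dense_sequence_exists (A : real -> Prop) :
  (exists x, A x) -> exists b, dense_sequence A b.
Proof.
  intros [x0 Hx0].
  assert (approx : forall i, exists a, A a /\
            forall x n, A x -> prefix_code x n = i -> agree_upto n x a).
  { intros i; destruct (classic (exists a n, A a /\ prefix_code a n = i))
      as [(a & n & Ha & <-)|none].
    - exists a; split; auto; intros x m _ E; apply (prefix_code_inj x a m n E).
    - exists x0; split; auto; intros x n Hx E; exfalso; eauto. }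
  apply functional_choice in approx; destruct approx as [b Hb].
  exists b; split; [ apply Hb | ]; intros x n Hx.
  exists (prefix_code x n); now apply Hb.
Qed.

Lemma dense_sequence_branching (A : real -> Prop) (b : nat -> real) :
  no_isolated A -> dense_sequence A b -> branching b.
Proof.
  intros Hiso [HbA Hdense] i n.
  destruct (Hiso (b i) (HbA i) n) as (x & Hx & Hne & Hag).
  destruct (first_difference (b i) x) as (m & Hm & Hdiff); [ congruence | ].
  destruct (Hdense x (S m) Hx) as [j Hj]; exists j, m; repeat split.
  - apply Nat.nlt_ge; intros Hlt; now apply Hdiff, Hag.
  - apply agree_upto_trans with x; auto; apply agree_upto_le with (S m); auto.
  - rewrite <- (Hj m) by lia; auto.
Qed.

Theorem perfect_set_coding (A : real -> Prop) :
  perfect_set A ->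
  exists b : nat -> real, (forall i, A (b i)) /\
    forall X y, (forall i, turing_le (b i) X) ->
      exists zs : list real, Forall A zs /\
        forall o, turing_le X o -> Forall (fun z => turing_le z o) zs -> turing_le y o.
Proof.
  intros (Hne & Hcl & Hiso); destruct (dense_sequence_exists A Hne) as [b Hb].
  exists b; split; [ apply Hb | ]; intros X y HX.
  destruct (coding_reals_exist (run X) (run_persistent X) b) with (A := A) (y := y)
    as (z & u & HzA & Hzu).
  { now apply dense_sequence_branching with A. }
  { intros i; now apply run_complete. }
  { exact Hcl. }
  { apply Hb. }
  exists (map (fun dr => z (fst dr) (snd dr)) (list_prod [false; true] (seq 0 3))); split.
  - apply Forall_map, Forall_forall; auto.
  - intros o Ho Hz; rewrite Forall_map, Forall_forall in Hz.
    apply (turing_le_departures_code o (run X) (computable_run X o Ho)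
             (fun d i => z d (i mod 3)) u); auto.
    intros d; apply (computable_periodic o (fun r => nat_of (z d r))); [ lia | ].
    intros r Hr; apply turing_le_computable1, (Hz (d, r)), in_prod.
    + destruct d; simpl; auto.
    + apply in_seq; lia.
Qed.

(** * The partial order *)

Inductive poset : Type :=
| Point (r : real)
| Bound (g : nat -> real)
| JointBound (g q : nat -> real).

Definition poset_le (p p' : poset) : Prop :=
  match p, p' with
  | Point r, Point r' => r = r'
  | Point r, Bound g => exists i, g i = r
  | Point r, JointBound g q => (exists i, g i = r) \/ (exists i, q i = r)
  | Bound g, Bound g' => g = g'
  | Bound g, JointBound g' _ => g = g'
  | JointBound g q, JointBound g' q' => g = g' /\ q = q'
  | _, _ => False
  end.

Lemma poset_partial_order : partial_order poset_le.
Proof.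
  split; [ intros []; simpl; auto | split ].
  - intros [] [] H H'; simpl in *; try contradiction; destruct H; subst; auto.
  - intros [] [] [] H H'; simpl in *; try contradiction; subst; auto;
      destruct H'; subst; auto.
Qed.

Lemma countable_set_enumerated {T : Type} (Q : T -> Prop) (f : nat -> T) :
  (forall x, Q x -> exists n, f n = x) -> countable_set Q.
Proof.
  intros Hf.
  assert (position : forall x, exists n, Q x -> f n = x).
  { intros x; destruct (classic (Q x)) as [Hx|]; [ | exists 0; tauto ].
    destruct (Hf x Hx) as [n Hn]; eauto. }
  apply functional_choice in position; destruct position as [g Hg].
  exists g; intros x y Hx Hy E; rewrite <- (Hg x Hx), <- (Hg y Hy); congruence.
Qed.

Definition interleave {T : Type} (f g : nat -> T) (n : nat) : T :=
  if Nat.even n then f (Nat.div2 n) else g (Nat.div2 n).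

Lemma interleave_even {T : Type} (f g : nat -> T) i : interleave f g (2 * i) = f i.
Proof. unfold interleave; now rewrite Nat.even_mul, Nat.div2_double. Qed.

Lemma interleave_odd {T : Type} (f g : nat -> T) i : interleave f g (S (2 * i)) = g i.
Proof.
  unfold interleave.
  now rewrite Nat.even_succ, <- Nat.negb_even, Nat.even_mul, Nat.div2_succ_double.
Qed.

Lemma poset_locally_countable : locally_countable poset_le.
Proof.
  intros [r|g|g q].
  - apply countable_set_enumerated with (fun _ => Point r).
    intros [] [H Hne]; simpl in H; try contradiction; subst; tauto.
  - apply countable_set_enumerated with (fun i => Point (g i)).
    intros [] [H Hne]; simpl in H; try contradiction; [ | subst; tauto ].
    destruct H as [i <-]; eauto.
  - apply countable_set_enumerated with
      (fun n => match n with 0 => Bound g | S n => Point (interleave g q n) end).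
    intros [] [H Hne]; simpl in H; try contradiction.
    + destruct H as [[i <-]|[i <-]].
      * exists (S (2 * i)); now rewrite interleave_even.
      * exists (S (S (2 * i))); now rewrite interleave_odd.
    + exists 0; now subst.
    + destruct H; subst; tauto.
Qed.

Lemma poset_height : height3 poset_le.
Proof.
  split.
  - set (g := fun _ _ : nat => true).
    exists (Point (g 0)), (Bound g), (JointBound g g).
    repeat split; try discriminate; now exists 0.
  - set (rank := fun p =>
      match p with Point _ => 0 | Bound _ => 1 | JointBound _ _ => 2 end).
    assert (rank_lt : forall p p', lt_of poset_le p p' -> rank p < rank p').
    { intros [] [] [H Hne]; simpl in *; try lia; try contradiction.
      - now subst.
      - now subst.
      - destruct H; now subst. }
    intros (a & b & c & d & Hab & Hbc & Hcd); apply rank_lt in Hab, Hbc, Hcd.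
    destruct d; simpl in *; lia.
Qed.

Lemma first_level_Point p : first_level poset_le p <-> exists r, p = Point r.
Proof.
  split.
  - intros H; destruct p as [r|g|g q]; eauto; exfalso;
      apply (H (Point (g 0))); split; simpl; eauto; discriminate.
  - intros [r ->] [] [H Hne]; simpl in H; try contradiction; now subst.
Qed.

Definition continuum (T : Type) : Prop := size_continuum (fun _ : T => True).

Lemma continuum_image {T U : Type} (Q : U -> Prop) (h : T -> U) :
  continuum T -> (forall t, Q (h t)) -> (forall t t', h t = h t' -> t = t') ->
  (forall u, Q u -> exists t, h t = u) -> size_continuum Q.
Proof.
  intros (e & _ & einj & esurj) hQ hinj hsurj; exists (fun r => h (e r)).
  split; [ auto | split; [ auto | ] ].
  intros u Hu; destruct (hsurj u Hu) as [t <-], (esurj t I) as [r <-]; eauto.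
Qed.

Lemma continuum_real : continuum real.
Proof. exists (fun r => r); repeat split; eauto. Qed.

Lemma continuum_sum T U : continuum T -> continuum U -> continuum (T + U).
Proof.
  intros (e & _ & einj & esurj) (e' & _ & einj' & esurj').
  set (tail := fun (r : real) n => r (S n)).
  set (scons := fun (a : bool) (r : real) n => match n with 0 => a | S n => r n end).
  assert (eq_head_tail : forall r s, r 0 = s 0 -> tail r = tail s -> r = s).
  { intros r s E0 E; apply functional_extensionality; intros [|n]; auto.
    exact (equal_f E n). }
  exists (fun r : real => if r 0 then inl (e (tail r)) else inr (e' (tail r))).
  split; [ auto | split ].
  - intros r s E; apply eq_head_tail; destruct (r 0), (s 0); try discriminate; auto;
      injection E; auto.
  - intros [t|u] _.
    + destruct (esurj t I) as [r <-]; now exists (scons true r).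
    + destruct (esurj' u I) as [r <-]; now exists (scons false r).
Qed.

Lemma continuum_prod T U : continuum T -> continuum U -> continuum (T * U).
Proof.
  intros (e & _ & einj & esurj) (e' & _ & einj' & esurj').
  exists (fun r : real => (e (fun i => r (2 * i)), e' (fun i => r (S (2 * i))))).
  split; [ auto | split ].
  - intros r s E; injection E as E E'; apply einj in E; apply einj' in E'.
    apply functional_extensionality; intros n.
    destruct (Nat.Even_or_Odd n) as [[i ->]|[i ->]].
    + exact (equal_f E i).
    + rewrite Nat.add_1_r; exact (equal_f E' i).
  - intros [t u] _; destruct (esurj t I) as [r <-], (esurj' u I) as [s <-].
    exists (interleave r s); f_equal; f_equal; apply functional_extensionality; intros i.
    + apply interleave_even.
    + apply interleave_odd.
Qed.

Lemma continuum_seq T : continuum T -> continuum (nat -> T).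
Proof.
  intros (e & _ & einj & esurj).
  exists (fun r : real => fun i => e (fun j => r (npair i j))); split; [ auto | split ].
  - intros r s E; apply functional_extensionality; intros n; rewrite <- (npair_eta n).
    pose proof (equal_f E (nfst n)) as En; apply einj in En; exact (equal_f En (nsnd n)).
  - intros f _; destruct (functional_choice (fun i r => e r = f i)) as [g Hg]; [ eauto | ].
    exists (fun n => g (nfst n) (nsnd n)); apply functional_extensionality; intros i.
    rewrite <- Hg; f_equal; apply functional_extensionality; intros j.
    now rewrite nfst_npair, nsnd_npair.
Qed.

Lemma poset_size : size_continuum (fun _ : poset => True).
Proof.
  apply (continuum_image (T := real + ((nat -> real) + (nat -> real) * (nat -> real))) _
    (fun t => match t with
              | inl r => Point r
              | inr (inl g) => Bound g
              | inr (inr (g, q)) => JointBound g q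
              end)).
  - auto using continuum_sum, continuum_prod, continuum_seq, continuum_real.
  - auto.
  - intros [r|[g|[g q]]] [r'|[g'|[g' q']]] E; try discriminate; injection E; intros;
      now subst.
  - intros [r|g|g q] _;
      [ now exists (inl r) | now exists (inr (inl g)) | now exists (inr (inr (g, q))) ].
Qed.

Lemma first_level_size : size_continuum (first_level poset_le).
Proof.
  apply (continuum_image _ Point).
  - exact continuum_real.
  - intros r; apply first_level_Point; eauto.
  - intros r r' E; now injection E.
  - intros p Hp; apply first_level_Point in Hp; destruct Hp as [r ->]; eauto.
Qed.

Lemma poset_no_embedding (f : poset -> real) (A : real -> Prop) :
  perfect_set A ->
  (forall a, A a -> exists p, first_level poset_le p /\ turing_eq a (f p)) ->
  ~ turing_embedding poset_le f.
Proof.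
  intros HA HAf Hf; destruct (perfect_set_coding A HA) as (b & HbA & Hb).
  assert (point : forall a, exists r, A a -> turing_eq a (f (Point r))).
  { intros a; destruct (classic (A a)) as [Ha|]; [ | exists a; tauto ].
    destruct (HAf a Ha) as (p & Hp & Hap); apply first_level_Point in Hp.
    destruct Hp as [r ->]; eauto. }
  apply functional_choice in point; destruct point as [point Hpoint].
  set (g := fun i => point (b i)); set (g' := fun i n => negb (g i n)).
  destruct (Hb (f (Bound g)) (f (Bound g'))) as (zs & HzsA & Hzs).
  { intros i; apply turing_le_trans with (f (Point (g i))); [ now apply Hpoint | ].
    apply Hf; simpl; eauto. }
  set (q := fun i => nth i (map point zs) (g 0)).
  assert (Hle : poset_le (Bound g') (JointBound g q)).
  { apply Hf, Hzs; [ now apply Hf | ].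
    rewrite Forall_forall in HzsA |- *; intros z Hz.
    apply turing_le_trans with (f (Point (point z))); [ now apply Hpoint, HzsA | ].
    apply Hf; right; destruct (In_nth (map point zs) (point z) (g 0)) as (i & _ & Hi).
    - now apply in_map.
    - now exists i. }
  apply equal_f with (x := 0) in Hle; apply equal_f with (x := 0) in Hle; unfold g' in Hle.
  destruct (g 0 0); discriminate.
Qed.

Theorem theorem1p2 :
  exists (P : Type) (le : P -> P -> Prop),
    partial_order le /\
    locally_countable le /\
    size_continuum (fun _ : P => True) /\
    height3 le /\
    size_continuum (first_level le) /\
    (forall f : P -> nat -> bool,
        (exists A : (nat -> bool) -> Prop,
            perfect_set A /\
            forall a, A a -> exists p, first_level le p /\ turing_eq a (f p)) ->
        ~ turing_embedding le f).
Proof.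
  exists poset, poset_le.
  split; [ exact poset_partial_order | ].
  split; [ exact poset_locally_countable | ].
  split; [ exact poset_size | ].
  split; [ exact poset_height | ].
  split; [ exact first_level_size | ].
  intros f (A & HA & HAf); now apply poset_no_embedding with A.
Qed.
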